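(* Let $(X,\tau)$ be an uncountable regular open Whyburn space. The following are equivalent: (1) $X$ is $\Omega^s$-Lindel\''{o}f; (2) $X$ is $\mathcal{K}_{\Omega}$-Lindel\''{o}f; (3) $t(\mathbf{0},Q_p(X,\mathbb{R}))=\omega$; (4) $t(f,Q_p(X,\mathbb{R}))=\omega$ for every continuous $f:X\to\mathbb{R}$; (5) $t(Q_p(X,\mathbb{D}))=\omega$.
   Context: All spaces are assumed regular. A function $f:X\to Y$ is quasicontinuous if for every $x\in X$, every open $V\ni f(x)$ and every open $U\ni x$ there is a nonempty open $W\subseteq U$ with $f(W)\subseteq V$. $Q_p(X,Y)$ is the set of all quasicontinuous functions $X\to Y$ with the topology of pointwise convergence; $\mathbb{D}=\{0,1\}$ is the discrete two-point space; $\mathbf{0}$ is the constant zero function. A space $X$ is open Whyburn if for every open $A\subseteq X$ and every $x\in\overline{A}\setminus A$ there is an open $B\subseteq A$ with $\overline{B}\setminus A=\{x\}$. A set $A$ is minimally bounded if $A\subseteq\overline{\mathrm{Int}A}$ and $\mathrm{Int}\overline{A}\subseteq A$. $\Omega^s$ is the collection of covers of $X$ by minimally bounded sets that are $\omega$-covers (every finite subset of $X$ is contained in some member). $\mathcal{K}$ is the collection of families $\mathcal{U}$ of open subsets of $X$ with $X=\bigcup\{\overline{U}:U\in\mathcal{U}\}$; $\mathcal{K}_\Omega$ is the set of $\mathcal{U}\in\mathcal{K}$ such that no element of $\mathcal{U}$ is dense in $X$ and for every finite $F\subseteq X$ there is $U\in\mathcal{U}$ with $F\subseteq\overline{U}$.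 For a collection $\mathcal{P}$ of covers, $X$ is $\mathcal{P}$-Lindel\''{o}f if each element of $\mathcal{P}$ has a countable subfamily belonging to $\mathcal{P}$. For a space $Z$ and $z\in Z$, $t(z,Z)=\omega$ means: whenever $z\in\overline{A}$, there is a countable $B\subseteq A$ with $z\in\overline{B}$; $t(Z)=\omega$ means $t(z,Z)=\omega$ for all $z\in Z$. *)

(* Defs.v *)
From HB Require Import structures.
From mathcomp Require Import all_boot all_order all_algebra.
From mathcomp Require Import all_classical all_reals all_analysis.
Set Implicit Arguments. Unset Strict Implicit. Unset Printing Implicit Defensive.
Local Open Scope classical_set_scope.

Definition regular_T1 (X : topologicalType) : Prop :=
  accessible_space X /\ regular_space X.

Definition uncountable_space (X : topologicalType) : Prop :=
  ~ countable [set: X].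

Definition open_whyburn (X : topologicalType) : Prop :=
  forall A : set X, open A -> forall x, closure A x -> ~ A x ->
    exists B : set X, [/\ open B, B `<=` A & closure B `\` A = [set x]].

Definition quasicontinuous (X Y : topologicalType) (f : X -> Y) : Prop :=
  forall (x : X) (V : set Y) (U : set X), open V -> V (f x) -> open U -> U x ->
    exists W : set X, [/\ open W, W !=set0, W `<=` U & f @` W `<=` V].

Definition Qp (X Y : topologicalType) : set {ptws X -> Y} :=
  [set f | quasicontinuous (f : X -> Y)].

(* t(z, Q) = omega, where Q carries the subspace topology of Z and z \in Q.
   Since the closure in the subspace Q of A `<=` Q is (closure A) `&` Q,
   this is the relative tightness condition. *)
Definition countable_tightness_at (Z : topologicalType) (Q : set Z) (z : Z)
  : Prop :=
  forall A : set Z, A `<=` Q -> closure A z ->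
    exists B : set Z, [/\ B `<=` A, countable B & closure B z].

Definition minimally_bounded (X : topologicalType) (A : set X) : Prop :=
  A `<=` closure (interior A) /\ interior (closure A) `<=` A.

Definition omega_cover (X : topologicalType) (U : set (set X)) : Prop :=
  forall F : set X, finite_set F -> exists2 A, U A & F `<=` A.

Definition Omega_s (X : topologicalType) : set (set (set X)) :=
  [set U | [/\ (forall A, U A -> minimally_bounded A),
               \bigcup_(A in U) A = [set: X] & omega_cover U]].

Definition Kfam (X : topologicalType) : set (set (set X)) :=
  [set U | (forall A, U A -> open A) /\
           \bigcup_(A in U) closure A = [set: X]].

Definition K_Omega (X : topologicalType) : set (set (set X)) :=
  [set U | [/\ Kfam U, (forall A, U A -> ~ dense A) &
      forall F : set X, finite_set F -> exists2 A, U A & F `<=` closure A]].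

Definition P_lindelof (X : topologicalType) (P : set (set (set X))) : Prop :=
  forall U, P U -> exists V, [/\ V `<=` U, countable V & P V].

Arguments Omega_s X : clear implicits.
Arguments K_Omega X : clear implicits.
Arguments Kfam X : clear implicits.
Arguments Qp X Y : clear implicits.
Arguments regular_T1 X : clear implicits.
Arguments uncountable_space X : clear implicits.
Arguments open_whyburn X : clear implicits.

(* Main.v *)
(** Everything passes through one property: every omega-cover by semi-open sets
    (A contained in the closure of its interior) has a countable
    omega-subcover.  It follows from K_Omega-Lindelofness because, by regularity
    and the open Whyburn property, a finite subset F of a semi-open A satisfies
    F <= cl B <= A for some open B.  It gives tightness at continuous f since
    the sets |h - f| < e are semi-open.  Conversely, tightness at a constant,
    tested on the two-valued functions jumping off cl U, gives
    K_Omega-Lindelofness.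

    For a merely quasicontinuous g : X -> bool the coincidence set {h = g} need
    not be semi-open at the points of the common boundary N of the interiors P
    and Q of the two fibres of g.  But the covering property makes N countable,
    so the finitely many conditions on N range over countably many cases, and it
    exhausts X \ N = P u Q by countably many open sets with closure missing N.
    On each of these, g is locally constant and the covering property applies. *)
Require Import Defs.
From HB Require Import structures.
From mathcomp Require Import all_boot all_order all_algebra.
From mathcomp Require Import all_classical all_reals all_analysis.
From mathcomp Require Import ring lra.
Import Order.TTheory GRing.Theory Num.Theory.
Import numFieldNormedType.Exports.
Local Open Scope classical_set_scope.
Local Open Scope ring_scope.

Definition semi_open (X : topologicalType) (A : set X) : Prop :=
  A `<=` closure (interior A).

(* The covers are indexed by functions, so that a subcover directly selects
   functions and not just their coincidence sets. *)
Definition semi_omega_lindelof (X : topologicalType) : Prop :=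
  forall (T : Type) (A : set T) (W : T -> set X),
    (forall h, A h -> semi_open X (W h)) ->
    (forall F : set X, finite_set F -> exists2 h, A h & F `<=` W h) ->
    exists B : set T, [/\ B `<=` A, countable B &
      forall F : set X, finite_set F -> exists2 h, B h & F `<=` W h].

(** Conditions at finitely many points generate a filter [G] that converges to [f] along every
    projection, so it contains all pointwise neighbourhoods of [f]. *)
Lemma closure_ptwsP (X : choiceType) (Y : topologicalType)
    (A : set {ptws X -> Y}) (f : {ptws X -> Y}) :
  closure A f <->
  forall (F : set X) (V : X -> set Y), finite_set F ->
    (forall x, nbhs (f x) (V x)) -> exists2 h, A h & forall x, F x -> V x (h x).
Proof.
split=> [Af F V finF nV | H].
  pose O : set {ptws X -> Y} := [set h | forall x, F x -> V x (h x)].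
  suff /Af[h [Ah Oh]] : nbhs f O by exists h.
  have -> : O = \bigcap_(x in F) [set h | V x (h x)] by [].
  move/finite_fsetP : finF => [E ->].
  apply: (@filter_bigI _ _ _ _ (nbhs f) (nbhs_filter f)) => x _.
  exact: (@proj_continuous _ (fun=> Y) x f (V x) (nV x)).
pose G : set_system {ptws X -> Y} := filter_from
  [set FV : set X * (X -> set Y) |
     finite_set FV.1 /\ forall x, nbhs (f x) (FV.2 x)]
  (fun FV => [set h | forall x, FV.1 x -> FV.2 x (h x)]).
have GF : Filter G.
  apply: filter_from_filter.
    by exists (set0, fun=> setT); split=> //= x; exact: filterT.
  move=> [F V] [F' V'] /= [finF nV] [finF' nV'].
  exists (F `|` F', fun x => V x `&` V' x) => /=.
    by split=> [|x]; [rewrite finite_setU | exact: filterI].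
  by move=> h hV; split=> x Fx; have [] := hV x _; [left | | right |].
have Gf : {ptws, G --> f}.
  apply/cvg_sup => x B [_ [[V oV <-] Vfx] VB].
  (* This total family is [V] at [x] and the whole space at every other point. *)
  exists ([set x], fun z => [set y | z = x -> V y]) => /=.
    split=> // z; have [->|zx] := pselect (z = x).
      by apply: filterS (open_nbhs_nbhs (conj oV Vfx)) => y Vy.
    by apply: filterE => y /zx.
  by move=> h /= /(_ x erefl erefl) Vhx; exact: VB.
move=> B /Gf[[F V] /= [finF nV] FVB].
have [h Ah hV] := H F V finF nV.
by exists h; split=> //; apply: FVB.
Qed.

(** * Semi-open sets and quasicontinuous functions *)

Section semi_open.
Context {X : topologicalType}.
Implicit Types A B D F : set X.

Lemma open_semi_open A : open A -> semi_open X A.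
Proof. by move=> /interior_id oA; rewrite /semi_open oA; exact: subset_closure. Qed.

Lemma semi_openU A B : semi_open X A -> semi_open X B -> semi_open X (A `|` B).
Proof.
move=> sA sB x [/sA|/sB]; apply: closureS; apply: interiorS.
  exact: subsetUl.
exact: subsetUr.
Qed.

Lemma semi_open_sub_closure A B : open A -> A `<=` B -> B `<=` closure A ->
  semi_open X B.
Proof.
move=> /interior_id oA AB BA x /BA; apply: closureS.
by rewrite -oA; exact: interiorS.
Qed.

Lemma semi_openI_open A B : open A -> semi_open X B -> semi_open X (A `&` B).
Proof.
move=> oA sB x [Ax /sB Bx] U Ux.
have [y [Biy [Uy Ay]]] := Bx _ (filterI Ux (open_nbhs_nbhs (conj oA Ax))).
by exists y; split=> //; rewrite interiorI; split=> //; rewrite (interior_id _).1.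
Qed.

Lemma closure_bigcup_finite (F : set X) (b : X -> set X) : finite_set F ->
  closure (\bigcup_(x in F) b x) = \bigcup_(x in F) closure (b x).
Proof.
move=> finF; apply/seteqP; split; last first.
  by apply: bigcup_sub => x Fx; apply: closureS; exact: bigcup_sup.
have cl : closed (\bigcup_(x in F) closure (b x)).
  by apply: closed_bigcup => // x _; exact: closed_closure.
rewrite [X in _ `<=` X](closure_id _).1 //; apply: closureS => x [y Fy byx].
by exists y => //; exact: subset_closure.
Qed.

Lemma regular_open_nbhs A x : regular_space X -> open A -> A x ->
  exists B, [/\ open B, B x & closure B `<=` A].
Proof.
move=> regX oA Ax.
have [B Bx BA] := regX x A (open_nbhs_nbhs (conj oA Ax)).
exists (interior B); split=> //; first exact: open_interior.
by apply: subset_trans BA; apply: closureS; exact: interior_subset.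
Qed.

Lemma regular_open_finite A F : regular_space X ->
  open A -> finite_set F -> F `<=` A ->
  exists B, [/\ open B, F `<=` B & closure B `<=` A].
Proof.
move=> regX oA finF FA.
have /choice[b bP] : forall x, exists B,
    A x -> [/\ open B, B x & closure B `<=` A].
  move=> x; have [|?] := pselect (A x); last by exists set0.
  by move=> /(regular_open_nbhs A x regX oA)[B ?]; exists B.
exists (\bigcup_(x in F) b x); split.
- by apply: bigcup_open => x /FA /bP[].
- by move=> x Fx; exists x => //; have [] := bP _ (FA _ Fx).
- by rewrite closure_bigcup_finite//; apply: bigcup_sub => x /FA /bP[].
Qed.

(** Regularity handles the points of [interior A]. At any other point [x] of [A], the open Whyburn
    property gives an open subset of [interior A] whose closure leaves [interior A] only at [x].
    Closure commutes with the finite union over [F]. *)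
Lemma semi_open_shrink A F : regular_space X -> open_whyburn X ->
  semi_open X A -> finite_set F -> F `<=` A ->
  exists B, [/\ open B, F `<=` closure B & closure B `<=` A].
Proof.
move=> regX whX sA finF FA.
have /choice[b bP] : forall x, exists B,
    A x -> [/\ open B, closure B x & closure B `<=` A].
  move=> x; have [Ax|?] := pselect (A x); last by exists set0.
  have [iAx|niAx] := pselect (interior A x).
    have [B [oB Bx BA]] := regular_open_nbhs _ x regX (open_interior A) iAx.
    exists B => _; split=> //; first exact: subset_closure.
    by apply: (subset_trans BA); exact: interior_subset.
  have [B [oB BA Bx]] := whX _ (open_interior A) x (sA _ Ax) niAx.
  exists B => _; split=> //.
    by have [] : (closure B `\` interior A) x by rewrite Bx.
  move=> y By; have [/interior_subset//|niAy] := pselect (interior A y).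
  by have -> : y = x by have : [set x] y by rewrite -Bx.
exists (\bigcup_(x in F) b x); split.
- by apply: bigcup_open => x /FA /bP[].
- rewrite closure_bigcup_finite// => x Fx; exists x => //.
  by have [] := bP _ (FA _ Fx).
- by rewrite closure_bigcup_finite//; apply: bigcup_sub => x /FA /bP[].
Qed.

Lemma quasicontinuous_semi_open (Y : topologicalType) (f : X -> Y) (V : set Y) :
  quasicontinuous f -> open V -> semi_open X (f @^-1` V).
Proof.
move=> qf oV x Vfx U; rewrite nbhsE => -[U' [oU' U'x] U'U].
have [W [oW [w Ww] WU' fWV]] := qf x V U' oV Vfx oU' U'x.
exists w; split; last exact/U'U/WU'.
by apply: filterS (open_nbhs_nbhs (conj oW Ww)) => y Wy; apply: fWV; exists y.
Qed.

Lemma quasicontinuous_close_semi_open (R : realType) (f g : X -> R) (e : R) :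
  quasicontinuous f -> continuous g ->
  semi_open X [set x | `|f x - g x| < e].
Proof.
move=> qf cg x /= xe U Ux.
(* Half of the slack at [x]: passing from [x] to [y] costs one error for [f] and one for [g]. *)
pose d := (e - `|f x - g x|) / 2.
have d0 : 0 < d by rewrite divr_gt0// subr_gt0.
have : nbhs x (U `&` (g @^-1` ball (g x) d)).
  by apply: filterI => //; apply: cg; exact: nbhsx_ballx.
rewrite nbhsE => -[G [oG Gx] GU].
have [W [oW [w Ww] WG fW]] := qf x (ball (f x) d) G
  (ball_open _ _) (ballxx _ d0) oG Gx.
exists w; split; last by have [] := GU _ (WG _ Ww).
apply: filterS (open_nbhs_nbhs (conj oW Ww)) => y Wy /=.
have /= : ball (f x) d (f y) by apply: fW; exists y.
have [_ /=] := GU _ (WG _ Wy).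
rewrite -!ball_normE /= => gd fd.
have -> : f y - g y = (f x - g x) - (f x - f y) + (g x - g y) by ring.
have := ler_normD ((f x - g x) - (f x - f y)) (g x - g y).
have := ler_normB (f x - g x) (f x - f y).
rewrite /d in gd fd; lra.
Qed.

(** Every neighbourhood of a point of [closure U] meets [U], and off [closure U] the function is
    locally constant. These are the test functions for tightness at a constant. *)
Lemma indicator_quasicontinuous (Y : topologicalType) (y0 y1 : Y) (U : set X) :
  open U ->
  quasicontinuous (fun x => if `[<closure U x>] then y0 else y1).
Proof.
move=> oU x V O oV Vx oO Ox; move: Vx; case: asboolP => [Ux|nUx] Vx.
  have [y [Uy Oy]] := Ux _ (open_nbhs_nbhs (conj oO Ox)).
  exists (O `&` U); split; [exact: openI | by exists y | exact: subIsetl |].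
  move=> _ [z [_ /subset_closure Uz] <-].
  by rewrite asboolT.
exists (O `&` ~` closure U); split.
- by apply: openI => //; apply: closed_openC; exact: closed_closure.
- by exists x.
- exact: subIsetl.
- by move=> _ [z [_ nUz] <-]; rewrite asboolF.
Qed.

End semi_open.

(** * Covering properties and tightness at continuous functions *)

Section lindelof.
Context {X : topologicalType}.

(** Closures of open sets are minimally bounded. A countable subfamily of the closures is lifted
    back by choosing one open set for each. *)
Lemma Omega_s_K_Omega : P_lindelof (Omega_s X) -> P_lindelof (K_Omega X).
Proof.
move=> OL U [[oU covU] ndU omU].
have [|V [VU cV [_ _ omV]]] := OL (closure @` U).
  split.
  - move=> _ [A UA <-]; split.
      by apply: closureS; rewrite -open_subsetE//; [exact: subset_closure|exact: oU].
    apply: (subset_trans (@interior_subset _ _)).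
    by rewrite -(closure_id (closure A)).1//; exact: closed_closure.
  - by rewrite bigcup_image.
  - by move=> F /omU[A UA FA]; exists (closure A) => //; exists A.
have /choice[c cP] : forall S, exists A, V S -> U A /\ closure A = S.
  by move=> S; have [/VU[A]|] := pselect (V S); [exists A | exists S].
have omcV F : finite_set F -> exists2 A, (c @` V) A & F `<=` closure A.
  move=> /omV[S VS FS]; exists (c S); first by exists S.
  by have [_ ->] := cP _ VS.
exists (c @` V); split.
- by move=> _ [S /cP[? _] <-].
- exact: sub_countable (card_image_le _ _) cV.
- split=> //; last by move=> _ [S /cP[/ndU ? _] <-].
  split; first by move=> _ [S /cP[/oU ? _] <-].
  apply/seteqP; split=> // x _.
  by have [A cA /(_ x erefl)] := omcV _ (finite_set1 x); exists A.
Qed.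

Lemma K_Omega_semi_omega : regular_space X -> open_whyburn X ->
  P_lindelof (K_Omega X) -> semi_omega_lindelof X.
Proof.
move=> regX whX KL T A W sW cW.
(* Members of a [K_Omega] family may not be dense. A dense [B] with [closure B] inside [W h] would
   force [W h = setT], a case where [h] alone suffices. *)
have [[h Ah WT]|nWT] := pselect (exists2 h, A h & W h = setT).
  exists [set h]; split=> [_ -> //|//|F _].
  by exists h => //; rewrite WT.
pose U := [set B : set X | open B /\ exists2 h, A h & closure B `<=` W h].
have omU F : finite_set F -> exists2 B, U B & F `<=` closure B.
  move=> finF; have [h Ah FW] := cW F finF.
  have [B [oB FB BW]] := semi_open_shrink _ _ regX whX (sW _ Ah) finF FW.
  by exists B => //; split=> //; exists h.
have [|V [VU cV [_ _ omV]]] := KL U.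
  split=> //.
    split=> [B []//|]; apply/seteqP; split=> // x _.
    by have [B UB /(_ x erefl)] := omU _ (finite_set1 x); exists B.
  move=> B [oB [h Ah BW]] dB; apply: nWT; exists h => //.
  apply/seteqP; split=> // x _; apply: BW => O.
  rewrite nbhsE => -[G [oG Gx] GO].
  have [|y [Gy By]] := dB G _ oG; first by exists x.
  by exists y; split=> //; exact: GO.
(* Covering the empty set provides a default value for the choice function outside [V]. *)
have [h0 Ah0 _] := cW _ (finite_set0 X).
have /choice[c cP] : forall B, exists h, V B -> A h /\ closure B `<=` W h.
  move=> B; have [/VU[_ [h Ah BW]]|] := pselect (V B); last by exists h0.
  by exists h.
exists (c @` V); split.
- by move=> _ [B /cP[? _] <-].
- exact: sub_countable (card_image_le _ _) cV.
- move=> F /omV[B VB FB]; exists (c B); first by exists B.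
  by apply: (subset_trans FB); have [_] := cP _ VB.
Qed.

Lemma semi_omega_Omega_s : semi_omega_lindelof X -> P_lindelof (Omega_s X).
Proof.
move=> SL U [mU covU omU].
have [|//|V [VU cV omV]] := SL _ U id; first by move=> A /mU[].
exists V; split=> //; split=> [A /VU/mU //| |//].
apply/seteqP; split=> // x _.
by have [A cA /(_ x erefl)] := omV _ (finite_set1 x); exists A.
Qed.

(** If [closure B] contains [F], then [ind B] agrees with the constant [y0] on [F]. Conversely [V0]
    separates [y0] from [y1], so values of [ind B] in [V0] on [F] put [F] inside [closure B]. *)
Lemma tightness_K_Omega (Y : topologicalType) (y0 y1 : Y) (V0 : set Y) :
  open V0 -> V0 y0 -> ~ V0 y1 ->
  countable_tightness_at (Qp X Y) (fun=> y0) -> P_lindelof (K_Omega X).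
Proof.
move=> oV0 V0y0 V0y1 tY U [[oU covU] ndU omU].
pose ind (B : set X) : {ptws X -> Y} :=
  fun x => if `[<closure B x>] then y0 else y1.
have [||C [CU cC clC]] := tY (ind @` U).
- by move=> _ [B /oU oB <-]; exact: indicator_quasicontinuous.
- apply/closure_ptwsP => F V /omU[B UB FB] nV.
  exists (ind B); first by exists B.
  move=> x /FB Bx; rewrite /ind asboolT//.
  exact: nbhs_singleton (nV x).
have /choice[c cP] : forall h, exists B, C h -> U B /\ ind B = h.
  by move=> h; have [/CU[B UB <-]|] := pselect (C h); [exists B | exists set0].
have omcC F : finite_set F -> exists2 B, (c @` C) B & F `<=` closure B.
  move=> finF; have /closure_ptwsP/(_ F (fun=> V0) finF)[] := clC.
    by move=> _; exact: open_nbhs_nbhs.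
  move=> h Ch hV0; exists (c h); first by exists h.
  move=> x Fx; have [_ ch] := cP _ Ch.
  by have := hV0 _ Fx; rewrite -[in V0 _]ch /ind; case: asboolP.
exists (c @` C); split.
- by move=> _ [h /cP[? _] <-].
- exact: sub_countable (card_image_le _ _) cC.
- split=> //; last by move=> _ [h /cP[/ndU ? _] <-].
  split; first by move=> _ [h /cP[/oU ? _] <-].
  apply/seteqP; split=> // x _.
  by have [A cA /(_ x erefl)] := omcC _ (finite_set1 x); exists A.
Qed.

(** For each [n] the covering property selects countably many functions, enough to approximate [f]
    within [1/(n+1)] on any finite set; their union over [n] is the required subset. *)
Lemma semi_omega_tightness_continuous (R : realType) (f : X -> R) :
  semi_omega_lindelof X -> continuous f -> countable_tightness_at (Qp X R) f.
Proof.
move=> SL cf A AQ clA.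
have /choice[C CP] : forall n : nat, exists C : set {ptws X -> R},
    [/\ C `<=` A, countable C & forall F : set X, finite_set F ->
      exists2 h, C h & F `<=` [set x | `|h x - f x| < n.+1%:R^-1]].
  move=> n; apply: (SL _ A (fun h => [set x | `|h x - f x| < n.+1%:R^-1])).
    by move=> h /AQ qh; exact: quasicontinuous_close_semi_open.
  move=> F finF.
  move/closure_ptwsP : clA => /(_ F (fun x => ball (f x) n.+1%:R^-1) finF)[].
    by move=> x; exact: nbhsx_ballx.
  move=> h Ah hF; exists h => // x /hF.
  by rewrite -ball_normE /= distrC.
exists (\bigcup_n C n); split.
- by apply: bigcup_sub => n _; have [] := CP n.
- by apply: bigcup_countable => // n _; have [] := CP n.
apply/closure_ptwsP => F V finF nV.
have /choice[d dP] : forall x, exists d : nat, ball (f x) d.+1%:R^-1 `<=` V x.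
  move=> x; have /nbhs_ballP[e /= e0 eV] := nV x.
  exists (Num.trunc e^-1); apply: subset_trans eV; apply: le_ball.
  rewrite invf_ple ?posrE//; exact/ltW/truncnS_gt.
(* As [F] is finite, a single tolerance serves all its points. *)
have [m mP] : exists m, forall x, F x -> (d x <= m)%N.
  have /finite_seqP[r ->] := finF.
  by exists (\max_(x <- r) d x)%N => x /= xr; exact: leq_bigmax_seq.
have [_ _ /(_ F finF)[h Ch hF]] := CP m.
exists h; first by exists m.
move=> x Fx; apply: dP; rewrite -ball_normE /= distrC.
apply: (lt_le_trans (hF _ Fx)).
by rewrite lef_pV2 ?posrE// ler_nat ltnS mP.
Qed.

(** * Tightness at quasicontinuous two-valued functions *)

(** The sets [D] u [G] with [G] finite form an omega-cover; in a countable subcover, countably many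
    finite sets [G] must cover the complement of [D]. *)
Lemma semi_omega_countable_setC (D : set X) :
  semi_omega_lindelof X -> open D -> dense D -> countable (~` D).
Proof.
move=> SL oD dD.
have clD : closure D = setT.
  apply/seteqP; split=> // x _ U; rewrite nbhsE => -[G [oG Gx] GU].
  have [|y [Gy Dy]] := dD G _ oG; first by exists x.
  by exists y; split=> //; exact: GU.
(* D u G is semi-open for every G because D is dense. *)
have [||C [CN cC omC]] := SL _ [set G : set X | finite_set G] (setU D).
- move=> G _; apply: (semi_open_sub_closure D) => //.
  by rewrite clD.
- by move=> F finF; exists F => //; exact: subsetUr.
apply: (@sub_countable _ _ _ (\bigcup_(G in C) G)); last first.
  by apply: bigcup_countable => // G /CN; exact: finite_set_countable.
apply: subset_card_le => x nDx.
have [G CG /(_ x erefl)[//|Gx]] := omC _ (finite_set1 x).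
by exists G.
Qed.

Lemma semi_omega_open_half (P Q : set X) :
  regular_space X -> semi_omega_lindelof X -> open P -> open Q ->
  P `&` Q = set0 -> ~` (P `|` Q) `<=` closure Q ->
  exists V : set (set X), [/\ countable V,
    forall A, V A -> open A /\ closure A `<=` P `|` Q &
    forall F, finite_set F -> F `<=` P -> exists2 A, V A & F `<=` A].
Proof.
move=> regX SL oP oQ PQ NQ.
(* As N <= cl Q, the set Q u N is semi-open; adjoining it to the sets A makes
   them an omega-cover of X without affecting their traces on P. *)
have [||V [VD cV omV]] := SL _
    [set A : set X | open A /\ closure A `<=` P `|` Q] (setU (~` P)).
- move=> A [oA _]; apply: semi_openU; last exact: open_semi_open.
  apply: (semi_open_sub_closure Q) => //.
    by move=> x Qx Px; have : (P `&` Q) x by []; rewrite PQ.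
  move=> x nPx; have [Qx|nQx] := pselect (Q x); first exact: subset_closure.
  by apply: NQ; case.
- move=> F finF.
  have [|A [oA FA AD]] := regular_open_finite _ (F `&` P) regX (openU oP oQ)
      (finite_setIl _ finF); first by move=> x [_ Px]; left.
  exists A => // x Fx; have [Px|nPx] := pselect (P x); last by left.
  by right; apply: FA.
exists V; split=> // F /omV[A VA FA] FP; exists A => // x Fx.
by have [/(_ (FP _ Fx))|] := FA _ Fx.
Qed.

(** Each half controls only the trace of [F] on its own side, so the family consists of unions of
    one set from each half. *)
Lemma semi_omega_open_exhaustion (P Q : set X) :
  regular_space X -> semi_omega_lindelof X -> open P -> open Q ->
  P `&` Q = set0 ->
  ~` (P `|` Q) `<=` closure P -> ~` (P `|` Q) `<=` closure Q ->
  exists V : set (set X), [/\ countable V,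
    forall A, V A -> closure A `<=` P `|` Q &
    forall F, finite_set F -> F `<=` P `|` Q -> exists2 A, V A & F `<=` A].
Proof.
move=> regX SL oP oQ PQ NP NQ.
have [V [cV VD omV]] := semi_omega_open_half _ _ regX SL oP oQ PQ NQ.
have [||V' [cV' VD' omV']] := semi_omega_open_half Q P regX SL oQ oP.
- by rewrite setIC.
- by rewrite setUC.
exists ((fun p => p.1 `|` p.2) @` (V `*` V')); split.
- exact: sub_countable (card_image_le _ _) (countableX cV cV').
- move=> _ [[A A'] /= [/VD[_ AD] /VD'[_ AD']] <-]; rewrite closureU.
  by rewrite subUset; split=> //; rewrite setUC.
- move=> F finF FPQ.
  have [|A VA FA] := omV (F `&` P) (finite_setIl _ finF).
    exact: subIsetr.
  have [|A' VA' FA'] := omV' (F `&` Q) (finite_setIl _ finF).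
    exact: subIsetr.
  exists (A `|` A'); first by exists (A, A').
  by move=> x Fx; have [Px|Qx] := FPQ _ Fx; [left; apply: FA|right; apply: FA'].
Qed.

Lemma semi_omega_tightness_bool (g : {ptws X -> bool}) :
  regular_space X -> semi_omega_lindelof X -> Qp X bool g ->
  countable_tightness_at (Qp X bool) g.
Proof.
move=> regX SL qg A AQ clA.
have oB (V : set bool) : open V by exact: discrete_open.
pose P b := interior (g @^-1` [set b]).
have oP b : open (P b) by exact: open_interior.
have Pg b x : P b x -> g x = b by move=> /interior_subset.
pose D := P true `|` P false.
have oD : open D by exact: openU.
have PD b x : P b x -> D x by case: b => ?; [left|right].
(* Fibres of [g] are semi-open, so it suffices to reach the closure of the fibre over [b]. If [g x]
   differs from [b], that fibre is the complement of the fibre through [x], which has no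
   neighbourhood of [x] inside it. *)
have ND b : ~` D `<=` closure (P b).
  move=> x nDx.
  suff : closure (g @^-1` [set b]) x.
    rewrite [closure (P b)](closure_id _).1; last exact: closed_closure.
    by apply: closureS; exact: quasicontinuous_semi_open.
  have [gxb|gxb] := eqVneq (g x) b; first exact: subset_closure.
  have -> : g @^-1` [set b] = ~` (g @^-1` [set g x]).
    apply/seteqP; split=> y /=; first by move=> -> /esym/eqP; exact/negP.
    by move: gxb; case: (g x) (g y) (b) => -[] [].
  by rewrite closure_setC => /PD.
have cN : countable (~` D).
  apply: semi_omega_countable_setC => // O [x Ox] oO.
  have [Dx|nDx] := pselect (D x); first by exists x.
  have [y [Py Oy]] := ND true x nDx O (open_nbhs_nbhs (conj oO Ox)).
  by exists y; split=> //; exact: PD Py.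
have PP : P true `&` P false = set0.
  by apply/seteqP; split=> // x [/Pg + /Pg] => ->.
have [V [cV VD omV]] := semi_omega_open_exhaustion _ _ regX SL
  (oP true) (oP false) PP (ND true) (ND false).
pose I := [set E : set X | E `<=` ~` D /\ finite_set E] `*` V.
have cI : countable I by apply: countableX => //; exact: countable_finite_subset.
pose W (S : set X) (h : {ptws X -> bool}) :=
  [set x | D x /\ h x = g x] `|` ~` closure S.
(* Agreement at boundary points restricts the candidate functions rather than the covering sets,
   which would lose semi-openness there. *)
pose AE (E : set X) := [set h | A h /\ forall x, E x -> h x = g x].
have /choice[C CP] : forall p : set X * set X, exists C : set {ptws X -> bool},
    I p -> [/\ C `<=` AE p.1, countable C & forall F : set X, finite_set F ->
      exists2 h, C h & F `<=` W p.2 h].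
  move=> [E S]; have [[/= [ED finE] VS]|] := pselect (I (E, S)); last first.
    by exists set0.
  have [||C ?] := SL _ (AE E) (W S); last by exists C.
  - move=> h [/AQ qh _]; apply: semi_openU; last first.
      by apply: open_semi_open; apply: closed_openC; exact: closed_closure.
    have -> : [set x | D x /\ h x = g x] =
        (P true `&` h @^-1` [set true]) `|` (P false `&` h @^-1` [set false]).
      apply/seteqP; split=> x /=.
        by move=> [[] Px ->]; [left|right]; split=> //; exact: Pg.
      by move=> [] [Px ->]; split; rewrite ?(Pg _ _ Px)//; exact: PD Px.
    by apply: semi_openU; apply: semi_openI_open => //;
      exact: quasicontinuous_semi_open.
  - move=> F finF.
    have finEF : finite_set (E `|` F) by rewrite finite_setU.
    have /closure_ptwsP/(_ _ (fun x => [set g x]) finEF)[] := clA.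
      by move=> x; exact: open_nbhs_nbhs.
    move=> h Ah hg; exists h; first by split=> // x Ex; apply: hg; left.
    move=> x Fx; have [Sx|] := pselect (closure S x); last by right.
    by left; split; [exact: VD Sx|apply: hg; right].
exists (\bigcup_(p in I) C p); split.
- by apply: bigcup_sub => p /CP[CA _ _] h /CA[].
- by apply: bigcup_countable => // p /CP[].
apply/closure_ptwsP => F U finF nU.
(* The part of [F] in [D] is handled by [S], the rest by the exact condition [E = F \ D]. *)
have [S VS FS] := omV (F `&` D) (finite_setIl _ finF) (@subIsetr _ _ _).
have IFS : I (F `\` D, S) by split=> //=; split=> [x []//|]; exact: finite_setD.
have [CA _ /(_ F finF)[h Ch hF]] := CP _ IFS.
exists h; first by exists (F `\` D, S).
move=> x Fx; suff -> : h x = g x by exact: nbhs_singleton (nU x).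
have [Dx|nDx] := pselect (D x); last by have [_ ->] := CA _ Ch.
have [[]//|] := hF _ Fx.
by case; apply/subset_closure/FS.
Qed.

End lindelof.

Theorem theorem3p6 (R : realType) (X : topologicalType) :
  regular_T1 X -> uncountable_space X -> open_whyburn X ->
  [<-> P_lindelof (Omega_s X);
       P_lindelof (K_Omega X);
       countable_tightness_at (Qp X R) (fun _ : X => (0 : R));
       (forall f : X -> R, continuous f -> countable_tightness_at (Qp X R) f);
       (forall g : {ptws X -> bool}, Qp X bool g ->
          countable_tightness_at (Qp X bool) g)].
Proof.
move=> [_ regX] _ whX.
have tR : countable_tightness_at (Qp X R) (fun _ : X => (0 : R)) ->
    P_lindelof (K_Omega X).
  by apply: (tightness_K_Omega _ (0 : R) 1 [set x | x < 1]) => //=; rewrite ltxx.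
have KS : P_lindelof (K_Omega X) -> semi_omega_lindelof X.
  exact: K_Omega_semi_omega.
tfae.
- exact: Omega_s_K_Omega.
- move=> /KS SL; apply: semi_omega_tightness_continuous => // x; exact: cvg_cst.
- by move=> /tR/KS SL f; exact: semi_omega_tightness_continuous.
(* The zero function is continuous, so the covering property is recovered from tightness there. *)
- move=> tc g; apply: semi_omega_tightness_bool => //; apply/KS/tR/tc.
  by move=> x; exact: cvg_cst.
(* Only tightness at the constant [false] is used to close the cycle. *)
- move=> tb; apply/semi_omega_Omega_s/KS.
  apply: (tightness_K_Omega _ false true [set false]) => //=.
    exact: discrete_open.
  apply: tb => x V U oV Vx oU Ux; exists U; split=> //; first by exists x.
  by move=> _ [y _ <-].
Qed.
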